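(* Let $r\ge 0$, $N\ge3$, and let $X$ be a Grassmannian Darboux net of rank $r$, i.e. a map $E(\mathbb{Z}^N)\to\mathbb{G}^d_r$ as defined in the context, in general position. Let $b^{ij}\in\mathrm{Mat}(r+1,r+1)$, $1\le i\neq j\le N$, be its rotation coefficients $$b^{ij}=\bigl((s^i_j)^{-1}-(s^i)^{-1}\bigr)s^j ,$$ for any choice of the matrices $s^i$ described in the context. Then the $b^{ij}$ satisfy the noncommutative discrete Darboux system $$b^{ij}_k=(b^{ij}+b^{ik}b^{kj})(I-b^{jk}b^{kj})^{-1},\qquad i,j,k\text{ pairwise distinct.}$$
   Context: $\mathbb{G}^d_r$ is the Grassmannian of $r$-planes in the real projective space $\mathbb{P}^d$, identified with the variety of $(r+1)$-dimensional vector subspaces of $\mathbb{R}^{d+1}$; dimensions of spans are projective. $\mathrm{Mat}(r+1,r+1)$ is the ring of real $(r+1)\times(r+1)$ matrices and $I$ its unit. $E(\mathbb{Z}^N)$ is the set of edges of the lattice $\mathbb{Z}^N$. A subscript $i$ denotes the shift by one in the $i$-th coordinate direction; superscripts are labels of coordinate directions. Grassmannian Darboux net of rank $r$: a map $E(\mathbb{Z}^N)\to\mathbb{G}^d_r$ such that for every elementary quadrilateral of $\mathbb{Z}^N$ the four $r$-planes corresponding to its sides lie in a $(2r+1)$-plane. Denote by $X^i(n)$ the $r$-plane assigned to the edge $[n,n+e_i]$, where $e_i$ is the $i$-th unit vector; thus the four $r$-planes at an elementary square are $X^i,X^j,X^i_j,X^j_i$. General position means here: any two of the four $r$-planes $X^i,X^j,X^i_j,X^j_i$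 at each elementary square span a $(2r+1)$-plane; $\dim\operatorname{span}(X^i,X^j,X^k)=3r+2$ at each vertex for all pairwise distinct $i,j,k$; and each $X^i$ has a basis forming the rows of an $(r+1)\times(d+1)$ matrix $x^i$ whose last $r+1$ columns form the unit matrix $I$ (this $x^i$ is then unique). With this normalization there are matrices $r^{ij}\in\mathrm{Mat}(r+1,r+1)$ such that $$x^i_j=r^{ij}x^i+(I-r^{ij})x^j .$$ General position implies that the $r^{ij}$ are invertible and that $r^{ij}_kr^{ik}=r^{ik}_jr^{ij}$ for pairwise distinct $i,j,k$, so that there exist invertible matrices $s^i$, assigned to edges parallel to the $i$-th axis, with $r^{ij}=s^i_j(s^i)^{-1}$ for all $j\ne i$. (With $y^i=(s^i)^{-1}x^i$ one has $y^i_j=y^i+b^{ij}y^j$.) *)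

(* Defs.v *)
From HB Require Import structures.
From mathcomp Require Import all_boot all_order all_algebra.
From mathcomp Require Import reals.

Set Implicit Arguments.
Unset Strict Implicit.
Unset Printing Implicit Defensive.

Import GRing.Theory.
Local Open Scope ring_scope.

(* An r-plane of the projective space P^d is a vector subspace of R^(d+1) of
   dimension r+1; all the dimensions below are written as (projective).+1. *)
Definition Grassmannian (R : realType) (d r : nat) :=
  {U : {vspace 'rV[R]_d.+1} | \dim U == r.+1}.

Definition lattice (N : nat) := 'rV[int]_N.

Definition shift (N : nat) (j : 'I_N) (n : lattice N) : lattice N :=
  n + delta_mx 0 j.

(* A function on the edges of Z^N: [f i n] is the value at [n, n + e_i]. *)
Definition edge_map (N : nat) (T : Type) := 'I_N -> lattice N -> T.

(* The sides of the elementary square at n in the directions i and j, in the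
   order X^i, X^j, X^i_j, X^j_i. *)
Definition sides (N : nat) (T : Type) (X : edge_map N T) (i j : 'I_N)
    (n : lattice N) : seq T :=
  [:: X i n; X j n; X i (shift j n); X j (shift i n)].

Definition Darboux_net (R : realType) (d r N : nat)
    (X : edge_map N (Grassmannian R d r)) : Prop :=
  forall (i j : 'I_N) (n : lattice N), i != j ->
    exists W : Grassmannian R d (2 * r + 1),
      all (fun A : Grassmannian R d r => (val A <= val W)%VS) (sides X i j n).

(* For r <= d, the indices d - r, ..., d are those of the last r+1 columns.
   A subspace of dimension r+1 in R^(d+1) exists only if r <= d, so the
   truncated subtraction and [inord] never take their default values below. *)
Definition last_cols (R : realType) (d r : nat) (x : 'M[R]_(r.+1, d.+1)) :
    'M[R]_r.+1 :=
  \matrix_(a, b) x a (inord (d - r + b)).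

Definition normalized_basis (R : realType) (d r : nat)
    (U : Grassmannian R d r) (x : 'M[R]_(r.+1, d.+1)) : Prop :=
  basis_of (val U) [seq row a x | a <- enum 'I_r.+1] /\ last_cols x = 1%:M.

Definition general_position (R : realType) (d r N : nat)
    (X : edge_map N (Grassmannian R d r)) : Prop :=
  [/\ forall (i j : 'I_N) (n : lattice N), i != j ->
        pairwise (fun A B : Grassmannian R d r =>
                    \dim (val A + val B)%VS == (2 * r + 1).+1)
                 (sides X i j n),
      forall (i j k : 'I_N) (n : lattice N), i != j -> j != k -> i != k ->
        \dim (val (X i n) + val (X j n) + val (X k n))%VS = (3 * r + 2).+1
    & forall (i : 'I_N) (n : lattice N),
        exists x : 'M[R]_(r.+1, d.+1), normalized_basis (X i n) x].

Definition normalization (R : realType) (d r N : nat)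
    (X : edge_map N (Grassmannian R d r))
    (x : edge_map N 'M[R]_(r.+1, d.+1)) : Prop :=
  forall (i : 'I_N) (n : lattice N), normalized_basis (X i n) (x i n).

Definition transition_matrices (R : realType) (d r N : nat)
    (x : edge_map N 'M[R]_(r.+1, d.+1))
    (rho : 'I_N -> 'I_N -> lattice N -> 'M[R]_r.+1) : Prop :=
  forall (i j : 'I_N) (n : lattice N), i != j ->
    x i (shift j n) = rho i j n *m x i n + (1%:M - rho i j n) *m x j n.

Definition potential (R : realType) (r N : nat)
    (rho : 'I_N -> 'I_N -> lattice N -> 'M[R]_r.+1)
    (s : edge_map N 'M[R]_r.+1) : Prop :=
  (forall (i : 'I_N) (n : lattice N), s i n \in unitmx) /\
  (forall (i j : 'I_N) (n : lattice N), i != j ->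
     rho i j n = s i (shift j n) *m invmx (s i n)).

Definition rotation_coef (R : realType) (r N : nat)
    (s : edge_map N 'M[R]_r.+1) (i j : 'I_N) (n : lattice N) : 'M[R]_r.+1 :=
  (invmx (s i (shift j n)) - invmx (s i n)) *m s j n.

(* Main.v *)
Require Import Defs.
From HB Require Import structures.
From mathcomp Require Import all_boot all_order all_algebra.
From mathcomp Require Import reals.
From mathcomp Require Import zify.

Set Implicit Arguments.
Unset Strict Implicit.
Unset Printing Implicit Defensive.

(** Rescaling the normalized bases to [y^i = (s^i)^-1 x^i] removes the
    coefficient in front of [x^i]: the transition formula becomes the
    translation [y^i_j = y^i + b^ij y^j] ([scaled_basis_shift]).  Shifting
    [y^i] along the two other axes in either order gives the same matrix, and
    the rows of [y^i], [y^j], [y^k] are linearly independent, so coefficients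
    may be compared ([rotation_coef_shift]):
      [b^ij_k = b^ij + b^ik_j b^kj]  and  [b^ik_j = b^ik + b^ij_k b^jk].
    Eliminating [b^ik_j] yields
      [b^ij_k (1 - b^jk b^kj) = b^ij + b^ik b^kj].
    It remains to invert [1 - b^jk b^kj] ([rotation_coef_unit]).  The planes
    [X^j_k] and [X^k_j] are two sides of an elementary square, so by
    general position the rows of [y^j_k = y^j + b^jk y^k] and
    [y^k_j = y^k + b^kj y^j] are independent.  Hence the block matrix with
    rows [1, b^jk] and [b^kj, 1] is invertible, and with it its Schur
    complement [1 - b^jk b^kj].

    The coefficients are compared on spans rather than on block matrices: when
    the dimension of a sum of subspaces is the sum of the dimensions, a sum of
    vectors vanishes only if each of them does ([addv_eq0_dim]), and a
    normalized basis determines the coefficients of its combinations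
    ([normalized_mulmx_eq0]). *)

Import GRing.Theory.
Local Open Scope ring_scope.

Lemma addv_eq0_dim (K : fieldType) (vT : vectType K) (U V : {vspace vT})
    (u v : vT) :
  \dim (U + V)%VS = (\dim U + \dim V)%N -> u \in U -> v \in V ->
  u + v = 0 -> u = 0 /\ v = 0.
Proof.
move=> dimUV uU vV uv0.
have /directv_add_unique UVunique : directv (U + V) by rewrite directvE /= dimUV.
have := UVunique u 0 v 0 uU (mem0v _) vV (mem0v _).
by rewrite uv0 addr0 eqxx => /esym/eqP[-> ->].
Qed.

Section NormalizedBases.
Variables (R : realType) (d r : nat).
Implicit Types (U V W : Grassmannian R d r) (x y z : 'M[R]_(r.+1, d.+1)).

Lemma dim_Grassmannian U : \dim (val U) = r.+1.
Proof. exact/eqP/(valP U). Qed.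

Lemma row_mulmx_in U x (A : 'M_r.+1) a :
  normalized_basis U x -> row a (A *m x) \in val U.
Proof.
case=> xU _; rewrite row_mul mulmx_sum_row.
apply: memv_suml => b _; apply: memvZ; apply: (basis_mem xU).
by apply: map_f; rewrite mem_enum.
Qed.

(** The unit block in the last columns of [x] lets one read [A] off [A x]. *)
Lemma normalized_mulmx_eq0 U x (A : 'M_r.+1) :
  normalized_basis U x -> A *m x = 0 -> A = 0.
Proof.
case=> _ x1 Ax0; rewrite -[A]mulmx1 -x1; apply/matrixP => a b.
have := congr1 (fun M : 'M_(r.+1, d.+1) => M a (inord (d - r + b))) Ax0.
by rewrite !mxE; apply: etrans; apply: eq_bigr => c _; rewrite mxE.
Qed.

Lemma normalized_free2 U V x y (A B : 'M_r.+1) :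
    normalized_basis U x -> normalized_basis V y ->
    \dim (val U + val V)%VS = (2 * r + 1).+1 ->
  A *m x + B *m y = 0 -> A = 0 /\ B = 0.
Proof.
move=> xU yV dimUV AB0.
have rows0 a : row a (A *m x) = 0 /\ row a (B *m y) = 0.
  apply: (@addv_eq0_dim _ _ (val U) (val V)); try exact: row_mulmx_in.
    by rewrite dimUV !dim_Grassmannian; lia.
  by rewrite -linearD AB0 linear0.
split; [apply: (normalized_mulmx_eq0 xU) | apply: (normalized_mulmx_eq0 yV)];
  by apply/row_matrixP => a; case: (rows0 a); rewrite row0.
Qed.

Lemma normalized_free3 U V W x y z (A B C : 'M_r.+1) :
    normalized_basis U x -> normalized_basis V y -> normalized_basis W z ->
    \dim (val U + val V + val W)%VS = (3 * r + 2).+1 ->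
  A *m x + B *m y + C *m z = 0 -> [/\ A = 0, B = 0 & C = 0].
Proof.
move=> xU yV zW dimUVW ABC0.
have dimU := dim_Grassmannian U; have dimV := dim_Grassmannian V.
have dimW := dim_Grassmannian W.
(* The general bound dim (U + V + W) <= dim (U + V) + dim W <= 3 (r + 1) is
   attained, hence so is each of its two steps. *)
have dimUV : \dim (val U + val V)%VS = (2 * r + 1).+1.
  have [leUV _] := dimv_add_leqif (val U) (val V).
  have [leUVW _] := dimv_add_leqif (val U + val V) (val W).
  by lia.
have rows0 a : row a (A *m x + B *m y) = 0 /\ row a (C *m z) = 0.
  apply: (@addv_eq0_dim _ _ (val U + val V)%VS (val W)).
  - by rewrite dimUVW dimUV dimW; lia.
  - by rewrite linearD; apply: memv_add; apply: row_mulmx_in.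
  - exact: row_mulmx_in.
  by rewrite -linearD ABC0 linear0.
have [|A0 B0] := normalized_free2 (A := A) (B := B) xU yV dimUV.
  by apply/row_matrixP => a; case: (rows0 a); rewrite row0.
split=> //; apply: (normalized_mulmx_eq0 zW).
by apply/row_matrixP => a; case: (rows0 a); rewrite row0.
Qed.

End NormalizedBases.

Lemma shiftC (N : nat) (j k : 'I_N) (n : lattice N) :
  shift j (shift k n) = shift k (shift j n).
Proof. exact: addrAC. Qed.

Section RotationCoefficients.
Variables (R : realType) (d r N : nat) (X : edge_map N (Grassmannian R d r)).
Variables (x : edge_map N 'M[R]_(r.+1, d.+1)).
Variables (rho : 'I_N -> 'I_N -> lattice N -> 'M[R]_r.+1).
Variables (s : edge_map N 'M[R]_r.+1).
Hypotheses (X_general : general_position X) (x_norm : normalization X x).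
Hypotheses (rhoP : transition_matrices x rho) (sP : potential rho s).

Definition scaled_basis : edge_map N 'M[R]_(r.+1, d.+1) :=
  fun i n => invmx (s i n) *m x i n.

Local Notation y := scaled_basis.
Local Notation b := (rotation_coef s).

Lemma potential_unit i n : s i n \in unitmx. Proof. by case: sP. Qed.

(** Since [rho^ij = s^i_j (s^i)^-1], multiplying the transition formula by
    [(s^i_j)^-1] turns its coefficients into [(s^i)^-1] and
    [(s^i_j)^-1 - (s^i)^-1]. *)
Lemma scaled_basis_shift i j n : i != j ->
  y i (shift j n) = y i n + b i j n *m y j n.
Proof.
move=> ij; rewrite /scaled_basis /rotation_coef rhoP // sP.2 //.
rewrite -!mulmxA mulmxA (mulmxA (s j n)) mulmxV ?potential_unit // mul1mx.
rewrite mulmxDr !mulmxA mulVmx ?potential_unit // mul1mx mulmxBr mulmx1.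
by rewrite !mulmxA mulVmx ?potential_unit // mul1mx.
Qed.

Lemma mulmx_invs_eq0 i n (A : 'M_r.+1) : A *m invmx (s i n) = 0 -> A = 0.
Proof. by move=> A0; rewrite -(mulmxKV (potential_unit i n) A) A0 mul0mx. Qed.

Lemma scaled_basis_free3 i j k n (A B C : 'M_r.+1) :
    i != j -> j != k -> i != k ->
  A *m y i n + B *m y j n + C *m y k n = 0 -> [/\ A = 0, B = 0 & C = 0].
Proof.
case: X_general => _ dim3 _ ij jk ik; rewrite !mulmxA => ABC0.
have [A0 B0 C0] := normalized_free3 (x_norm i n) (x_norm j n) (x_norm k n)
  (dim3 i j k n ij jk ik) ABC0.
by split; apply: mulmx_invs_eq0; eassumption.
Qed.

Lemma scaled_basis_shift_free2 j k n (A B : 'M_r.+1) : j != k ->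
  A *m y j (shift k n) + B *m y k (shift j n) = 0 -> A = 0 /\ B = 0.
Proof.
case: X_general => dim2 _ _ jk; rewrite !mulmxA => AB0.
have /eqP dimX : \dim (val (X j (shift k n)) + val (X k (shift j n)))%VS
    == (2 * r + 1).+1.
  by have /= := dim2 j k n jk; rewrite !andbT => /and3P[_ _].
have [A0 B0] := normalized_free2 (x_norm j (shift k n)) (x_norm k (shift j n))
  dimX AB0.
by split; apply: mulmx_invs_eq0; eassumption.
Qed.

(** Both equations come from the two ways of expanding [y^i] shifted along
    the axes [j] and [k] in terms of the independent [y^i], [y^j], [y^k]. *)
Lemma rotation_coef_shift i j k n : i != j -> j != k -> i != k ->
  b i j (shift k n) = b i j n + b i k (shift j n) *m b k j n /\
  b i k (shift j n) = b i k n + b i j (shift k n) *m b j k n.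
Proof.
move=> ij jk ik; have kj : k != j by rewrite eq_sym.
have := congr1 (y i) (shiftC j k n).
rewrite !scaled_basis_shift // !mulmxDr => eq_y.
have [||||_ Bj Bk] := @scaled_basis_free3 i j k n 0
  (b i j (shift k n) - (b i j n + b i k (shift j n) *m b k j n))
  (b i k n + b i j (shift k n) *m b j k n - b i k (shift j n)) => //.
  (* The relation to prove is [eq_y] up to order, minus [y i n] on both sides. *)
  rewrite mul0mx add0r !(mulmxDl, mulNmx) addrACA -opprD.
  apply/eqP; rewrite subr_eq0 addrCA -[X in _ == X]addrA.
  rewrite (addrC (_ *m b k j n *m _)); apply/eqP/(addrI (y i n)).
  by rewrite !(addrA, mulmxA) in eq_y *.
by split; [|symmetry]; apply/eqP; rewrite -subr_eq0; apply/eqP.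
Qed.

(** If the matrix [K] satisfies [K (1 - b^jk b^kj) = 0], then
    [K y^j_k - K b^jk y^k_j = 0], whence [K = 0] by independence of [X^j_k]
    and [X^k_j]. *)
Lemma rotation_coef_unit j k n : j != k ->
  1%:M - b j k n *m b k j n \in unitmx.
Proof.
move=> jk; have kj : k != j by rewrite eq_sym.
rewrite -row_free_unit -kermx_eq0; set K := kermx _.
have /eqP : K *m (1%:M - b j k n *m b k j n) = 0 := mulmx_ker _.
rewrite mulmxBr mulmx1 mulmxA subr_eq0 => /eqP KE.
have [||-> //] := @scaled_basis_shift_free2 j k n K (- (K *m b j k n)) => //.
rewrite !scaled_basis_shift // !mulmxDr !mulNmx.
(* The factors are given explicitly: [b] and [y] themselves unfold to products,
   which [mulmxA] would otherwise reassociate. *)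
rewrite (mulmxA K (b j k n)) (mulmxA _ (b k j n)).
by rewrite addrA addrK -KE subrr.
Qed.

End RotationCoefficients.

Theorem mainTheorem4 (R : realType) (d r N : nat) (hN : (3 <= N)%N)
    (X : edge_map N (Grassmannian R d r))
    (X_Darboux : Darboux_net X) (X_general : general_position X)
    (x : edge_map N 'M[R]_(r.+1, d.+1)) (x_norm : normalization X x)
    (rho : 'I_N -> 'I_N -> lattice N -> 'M[R]_r.+1)
    (rhoP : transition_matrices x rho)
    (s : edge_map N 'M[R]_r.+1) (sP : potential rho s)
    (b : 'I_N -> 'I_N -> lattice N -> 'M[R]_r.+1)
    (bP : forall (i j : 'I_N) (n : lattice N), i != j ->
       b i j n = rotation_coef s i j n)
    (i j k : 'I_N) (n : lattice N) (ij : i != j) (jk : j != k) (ik : i != k) :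
  1%:M - b j k n *m b k j n \in unitmx /\
  b i j (shift k n) =
    (b i j n + b i k n *m b k j n) *m invmx (1%:M - b j k n *m b k j n).
Proof.
have kj : k != j by rewrite eq_sym.
rewrite !bP //; have u := rotation_coef_unit X_general x_norm rhoP sP n jk.
split=> //; apply: (can_inj (mulmxK u)); rewrite mulmxKV //.
have [bij_k bik_j] := rotation_coef_shift X_general x_norm rhoP sP n ij jk ik.
by rewrite mulmxBr mulmx1 mulmxA {1}bij_k bik_j mulmxDl addrA addrK.
Qed.
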